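(* Assume that $\gamma$ is a smooth closed Legendrian curve in the first Heisenberg group $\mathbb M(0)$. Then $$\int_\gamma \big(1+k\,g_\theta(\gamma,J\dot\gamma)\big)\,ds=0 .$$
   Context: The first Heisenberg group $\mathbb M(0)$ is $\mathbb R^3$ with coordinates $(x,y,z)$ and contact form $\theta=x\,dy-y\,dx+dz$. Set $X_1=\partial_x+y\partial_z$, $X_2=\partial_y-x\partial_z$, $T=\partial_z$ (the Reeb field). $g_\theta$ is the Riemannian metric for which $\{X_1,X_2,T\}$ is orthonormal; $J$ is given by $JX_1=X_2$, $JX_2=-X_1$, $JT=0$. $\nabla$ is the Tanaka connection, for which $X_1,X_2,T$ are parallel. For a closed (immersed) curve $\gamma=(\gamma^1,\gamma^2,\gamma^3):S^1\to\mathbb M(0)$, $s$ is the arc-length parameter with respect to $g_\theta$, $\dot\gamma=d\gamma/ds$, and the curvature is $k=g_\theta(\nabla_{\dot\gamma}\dot\gamma,J\dot\gamma)$. $\gamma$ is Legendrian if $g_\theta(\dot\gamma,T)\equiv0$. In $g_\theta(\gamma,J\dot\gamma)$, $\gamma$ denotes the position vector field $\gamma^1\partial_x+\gamma^2\partial_y+\gamma^3\partial_z=\gamma^1X_1+\gamma^2X_2+\gamma^3T$ along the curve. *)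

(* Defs.v *)
From Stdlib Require Import Reals Lra.
From Coquelicot Require Import Coquelicot.
Open Scope R_scope.

(** Points of the Heisenberg group, and tangent vectors
    [v = cx v d/dx + cy v d/dy + cz v d/dz], both as triples of coordinates. *)
Definition R3 : Type := (R * R * R)%type.
Definition cx (p : R3) : R := fst (fst p).
Definition cy (p : R3) : R := snd (fst p).
Definition cz (p : R3) : R := snd p.

Definition theta (p v : R3) : R := cx p * cy v - cy p * cx v + cz v.

Definition X1 (p : R3) : R3 := (1, 0, cy p).
Definition X2 (p : R3) : R3 := (0, 1, - cx p).
Definition Reeb (p : R3) : R3 := (0, 0, 1).

(** [a X1 + b X2 + c T] at [p]. *)
Definition frame (p : R3) (a b c : R) : R3 :=
  (a * cx (X1 p) + b * cx (X2 p) + c * cx (Reeb p),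
   a * cy (X1 p) + b * cy (X2 p) + c * cy (Reeb p),
   a * cz (X1 p) + b * cz (X2 p) + c * cz (Reeb p)).

(** The coframe dual to [X1], [X2], [T] is [dx], [dy], [theta]. *)
Lemma frame_decomp (p v : R3) : v = frame p (cx v) (cy v) (theta p v).
Proof.
destruct p as [[x y] z], v as [[a b] c].
unfold frame, theta, X1, X2, Reeb, cx, cy, cz; simpl.
f_equal; [f_equal|]; ring.
Qed.

Lemma coframe_frame (p : R3) (a b c : R) :
  cx (frame p a b c) = a /\ cy (frame p a b c) = b /\
  theta p (frame p a b c) = c.
Proof.
unfold frame, theta, X1, X2, Reeb, cx, cy, cz; simpl.
repeat split; ring.
Qed.

(** The metric [g_theta = dx^2 + dy^2 + theta^2]. *)
Definition metric (p v w : R3) : R :=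
  cx v * cx w + cy v * cy w + theta p v * theta p w.

Lemma metric_orthonormal (p : R3) :
  metric p (X1 p) (X1 p) = 1 /\ metric p (X2 p) (X2 p) = 1 /\
  metric p (Reeb p) (Reeb p) = 1 /\ metric p (X1 p) (X2 p) = 0 /\
  metric p (X1 p) (Reeb p) = 0 /\ metric p (X2 p) (Reeb p) = 0.
Proof.
unfold metric, theta, X1, X2, Reeb, cx, cy, cz; simpl.
repeat split; ring.
Qed.

(** The linear map with [J X1 = X2], [J X2 = - X1], [J T = 0]. *)
Definition J (p v : R3) : R3 := frame p (- cy v) (cx v) 0.

Lemma J_frame (p : R3) :
  J p (X1 p) = X2 p /\ J p (X2 p) = frame p (-1) 0 0 /\ J p (Reeb p) = (0, 0, 0).
Proof.
unfold J, frame, X1, X2, Reeb, cx, cy, cz; simpl.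
repeat split; (f_equal; [f_equal|]; ring).
Qed.

(** The position vector field [x d/dx + y d/dy + z d/dz]. *)
Definition position (p : R3) : R3 := p.

Lemma position_frame (p : R3) : position p = frame p (cx p) (cy p) (cz p).
Proof.
destruct p as [[x y] z].
unfold position, frame, X1, X2, Reeb, cx, cy, cz; simpl.
f_equal; [f_equal|]; ring.
Qed.

Definition smooth (f : R -> R) : Prop := forall (n : nat) (t : R), ex_derive_n f n t.

Definition smooth_curve (gamma : R -> R3) : Prop :=
  smooth (fun t => cx (gamma t)) /\ smooth (fun t => cy (gamma t)) /\
  smooth (fun t => cz (gamma t)).

Definition velocity (gamma : R -> R3) (t : R) : R3 :=
  (Derive (fun u => cx (gamma u)) t,
   Derive (fun u => cy (gamma u)) t,
   Derive (fun u => cz (gamma u)) t).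

(** A smooth immersion of the circle [R / P Z], seen as a [P]-periodic map on
    [R] in an arbitrary regular parameter [t]. *)
Definition closed_immersed_curve (P : R) (gamma : R -> R3) : Prop :=
  0 < P /\
  smooth_curve gamma /\
  (forall t, gamma (t + P) = gamma t) /\
  (forall t, velocity gamma t <> (0, 0, 0)).

Definition speed (gamma : R -> R3) (t : R) : R :=
  sqrt (metric (gamma t) (velocity gamma t) (velocity gamma t)).

Definition arclength (gamma : R -> R3) (t : R) : R := RInt (speed gamma) 0 t.

(** Functions along the curve are given in the parameter [t]; since
    [ds = speed dt], [d/ds] is [(1 / speed) d/dt] (see [d_ds_arclength]). *)
Definition d_ds (gamma : R -> R3) (f : R -> R) (t : R) : R :=
  Derive f t / speed gamma t.

(** [d gamma / ds]. *)
Definition tangent (gamma : R -> R3) (t : R) : R3 :=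
  (d_ds gamma (fun u => cx (gamma u)) t,
   d_ds gamma (fun u => cy (gamma u)) t,
   d_ds gamma (fun u => cz (gamma u)) t).

(** Covariant derivative [nabla_{d gamma / ds} V] of a vector field [V] along
    [gamma], for the connection making [X1], [X2], [T] parallel: it
    differentiates the components of [V] in this frame. *)
Definition nabla_ds (gamma V : R -> R3) (t : R) : R3 :=
  frame (gamma t)
    (d_ds gamma (fun u => cx (V u)) t)
    (d_ds gamma (fun u => cy (V u)) t)
    (d_ds gamma (fun u => theta (gamma u) (V u)) t).

Lemma nabla_ds_frame (gamma : R -> R3) (a b c : R -> R) (t : R) :
  nabla_ds gamma (fun u => frame (gamma u) (a u) (b u) (c u)) t =
  frame (gamma t) (d_ds gamma a t) (d_ds gamma b t) (d_ds gamma c t).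
Proof.
unfold nabla_ds, d_ds.
f_equal; f_equal; apply Derive_ext; intros u; apply coframe_frame.
Qed.

Definition curvature (gamma : R -> R3) (t : R) : R :=
  metric (gamma t)
    (nabla_ds gamma (tangent gamma) t) (J (gamma t) (tangent gamma t)).

Definition legendrian (gamma : R -> R3) : Prop :=
  forall t, metric (gamma t) (tangent gamma t) (Reeb (gamma t)) = 0.

(** [f] is integrable in [ds] over one turn of the closed curve, with
    integral [I]. *)
Definition is_curve_integral (P : R) (gamma : R -> R3) (f : R -> R) (I : R) : Prop :=
  is_RInt (fun t => f t * speed gamma t) 0 P I.

Lemma smooth_continuous (f : R -> R) (t : R) : smooth f -> continuous f t.
Proof.
intros H; apply (ex_derive_continuous (K := R_AbsRing) (V := R_NormedModule)).
exact (H 1%nat t).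
Qed.

Lemma smooth_continuous_Derive (f : R -> R) (t : R) :
  smooth f -> continuous (Derive f) t.
Proof.
intros H; apply (ex_derive_continuous (K := R_AbsRing) (V := R_NormedModule)).
exact (H 2%nat t).
Qed.

Lemma speed_continuous (gamma : R -> R3) (t : R) :
  smooth_curve gamma -> continuous (speed gamma) t.
Proof.
intros (Hx & Hy & Hz).
pose proof (smooth_continuous _ t Hx) as x0.
pose proof (smooth_continuous _ t Hy) as y0.
pose proof (smooth_continuous_Derive _ t Hx) as x1.
pose proof (smooth_continuous_Derive _ t Hy) as y1.
pose proof (smooth_continuous_Derive _ t Hz) as z1.
unfold speed, metric, theta.
apply continuous_comp; [|apply continuous_sqrt].
repeat first
  [ assumption
  | apply (continuous_plus (V := R_NormedModule))
  | apply (continuous_opp (V := R_NormedModule))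
  | apply (continuous_mult (K := R_AbsRing)) ].
Qed.

Lemma is_derive_arclength (gamma : R -> R3) (t : R) :
  smooth_curve gamma -> is_derive (arclength gamma) t (speed gamma t).
Proof.
intros H; apply (is_derive_RInt (V := R_NormedModule) _ _ 0).
- apply filter_forall; intros u.
  apply (RInt_correct (V := R_CompleteNormedModule)).
  apply (ex_RInt_continuous (V := R_CompleteNormedModule)).
  intros; now apply speed_continuous.
- now apply speed_continuous.
Qed.

Lemma speed_pos (P : R) (gamma : R -> R3) (t : R) :
  closed_immersed_curve P gamma -> 0 < speed gamma t.
Proof.
intros (_ & _ & _ & H); specialize (H t).
apply sqrt_lt_R0; unfold metric.
set (v := velocity gamma t) in *; set (w := theta (gamma t) v).
destruct (Rle_lt_dec (cx v * cx v + cy v * cy v + w * w) 0) as [Hle|]; [|assumption].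
exfalso; apply H.
assert (Hx : cx v = 0) by nra.
assert (Hy : cy v = 0) by nra.
assert (Hw : w = 0) by nra.
rewrite (frame_decomp (gamma t) v).
fold w; rewrite Hx, Hy, Hw.
unfold frame; f_equal; [f_equal|]; ring.
Qed.

Lemma d_ds_arclength (P : R) (gamma : R -> R3) (F : R -> R) (t l : R) :
  closed_immersed_curve P gamma ->
  is_derive F (arclength gamma t) l ->
  d_ds gamma (fun u => F (arclength gamma u)) t = l.
Proof.
intros H HF; pose proof (speed_pos _ _ t H) as Hpos.
assert (Hs := is_derive_arclength gamma t (proj1 (proj2 H))).
unfold d_ds.
assert (HD : Derive (fun u => F (arclength gamma u)) t = speed gamma t * l)
  by exact (is_derive_unique _ _ _ (is_derive_comp F (arclength gamma) t l _ HF Hs)).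
rewrite HD; field; lra.
Qed.

(* Main.v *)
Require Import Defs.
From Stdlib Require Import Reals Lra.
From Coquelicot Require Import Coquelicot.
Open Scope R_scope.

(** The formula is the Heisenberg version of Minkowski's identity for plane
    curves, and it is proved the same way: the integrand is an exact derivative,
    [1 + k g(gamma, J gamma') = d/ds g(gamma, gamma')], and the integral of a
    derivative over a closed curve vanishes.

    On a Legendrian curve the unit tangent has no Reeb component, so it is
    [a X1 + b X2] with [a^2 + b^2 = 1], where [a = dx/ds] and [b = dy/ds].  Since
    [X1] and [X2] are parallel, the curvature is the one of the projection of
    the curve to the [(x, y)]-plane, and [a], [b] obey the planar Frenet equations
    [da/ds = - k b] and [db/ds = k a] ([frenet_cx], [frenet_cy]).  Hence
    [d/ds (x a + y b) = a^2 + b^2 + k (y a - x b)], and [y a - x b] is exactly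
    [g(gamma, J gamma')].

    The fundamental theorem of calculus asks for a continuous integrand; this
    comes from [curvature_speed_legendrian], which writes [k ds/dt] through the
    first two derivatives of [x] and [y]. *)

(** * The geometry of the frame along a curve *)

Lemma theta_tangent (gamma : R -> R3) (t : R) :
  theta (gamma t) (tangent gamma t) =
  theta (gamma t) (velocity gamma t) / speed gamma t.
Proof.
unfold theta, tangent, velocity, d_ds, cx, cy, cz, Rdiv; simpl; ring.
Qed.

(** [J w] has no Reeb component, so only the horizontal part of [v] is seen. *)
Lemma metric_J (p v w : R3) :
  metric p v (J p w) = cy v * cx w - cx v * cy w.
Proof.
unfold metric, J.
destruct (coframe_frame p (- cy w) (cx w) 0) as (-> & -> & ->); ring.
Qed.

Lemma curvature_components (gamma : R -> R3) (t : R) :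
  curvature gamma t =
  cx (tangent gamma t) * d_ds gamma (fun u => cy (tangent gamma u)) t -
  cy (tangent gamma t) * d_ds gamma (fun u => cx (tangent gamma u)) t.
Proof.
unfold curvature; rewrite metric_J; unfold nabla_ds.
match goal with |- context [frame ?p ?a ?b ?c] =>
  destruct (coframe_frame p a b c) as (-> & -> & _) end.
ring.
Qed.

(** * Calculus on the line *)

(** Normalizing a plane vector [(f, g)] turns it at the angular speed
    [(f g' - g f') / (f^2 + g^2)], so its first component changes by minus this
    speed times the second one. *)
Lemma is_derive_normalized (f g : R -> R) (t f' g' : R) :
  0 < f t * f t + g t * g t ->
  is_derive f t f' -> is_derive g t g' ->
  is_derive (fun u => f u / sqrt (f u * f u + g u * g u)) t
    (- ((f t * g' - g t * f') / (f t * f t + g t * g t)) *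
     (g t / sqrt (f t * f t + g t * g t))).
Proof.
intros Hpos Hf Hg.
pose proof (sqrt_lt_R0 _ Hpos) as Hs.
pose proof (sqrt_sqrt _ (Rlt_le _ _ Hpos)) as Hss.
pose proof (is_derive_unique _ _ _ Hf) as Df.
pose proof (is_derive_unique _ _ _ Hg) as Dg.
auto_derive.
- repeat split; try (eexists; eassumption); try assumption; lra.
- change (Derive (fun u => f u) t) with (Derive f t).
  change (Derive (fun u => g u) t) with (Derive g t).
  rewrite Df, Dg.
  set (s := sqrt (f t * f t + g t * g t)) in *.
  rewrite <- Hss.
  (* Once the denominator [s^3] is cleared, the two sides agree modulo
     [s^2 = f^2 + g^2]. *)
  apply Rmult_eq_reg_r with (s * s * s); [|apply Rgt_not_eq; nra].
  field_simplify; [|lra|lra].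
  replace (s ^ 2) with (f t * f t + g t * g t) by (rewrite <- Hss; ring).
  field.
Qed.

Lemma is_derive_Derive_smooth (f : R -> R) (t : R) :
  smooth f -> is_derive (Derive f) t (Derive (Derive f) t).
Proof. intros H; apply Derive_correct; exact (H 2%nat t). Qed.

Lemma Derive_periodic (f : R -> R) (p t : R) :
  (forall u, f (u + p) = f u) -> Derive f (t + p) = Derive f t.
Proof.
intros H; unfold Derive; f_equal; apply Lim_ext; intros h.
replace (t + p + h) with (t + h + p) by ring.
now rewrite !H.
Qed.

(** * Legendrian curves *)

Section Legendrian.

Variables (P : R) (gamma : R -> R3).
Hypothesis hclosed : closed_immersed_curve P gamma.
Hypothesis hleg : legendrian gamma.

Let x (t : R) : R := cx (gamma t).
Let y (t : R) : R := cy (gamma t).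

Lemma theta_velocity_legendrian (t : R) :
  theta (gamma t) (velocity gamma t) = 0.
Proof.
pose proof (speed_pos _ _ t hclosed) as Hw.
assert (H : theta (gamma t) (tangent gamma t) = 0).
{ rewrite <- (hleg t); unfold metric.
  unfold theta, Reeb, cx, cy, cz; simpl; ring. }
rewrite theta_tangent in H.
apply Rmult_eq_reg_r with (/ speed gamma t).
- rewrite Rmult_0_l; exact H.
- apply Rinv_neq_0_compat; lra.
Qed.

Lemma speed_legendrian (t : R) :
  speed gamma t = sqrt (Derive x t * Derive x t + Derive y t * Derive y t).
Proof.
unfold speed, metric; rewrite theta_velocity_legendrian.
f_equal; unfold velocity, x, y; simpl; unfold cx, cy; simpl; ring.
Qed.

Lemma speed_sqr_legendrian (t : R) :
  speed gamma t * speed gamma t =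
  Derive x t * Derive x t + Derive y t * Derive y t.
Proof. rewrite speed_legendrian; apply sqrt_sqrt; nra. Qed.

(** * Frenet equations for the unit tangent *)

(** The angular speed [k ds/dt] of the tangent, in the parameter [t]. *)
Let turning (t : R) : R :=
  (Derive x t * Derive (Derive y) t - Derive y t * Derive (Derive x) t) /
  (speed gamma t * speed gamma t).

Lemma is_derive_cx_tangent (t : R) :
  is_derive (fun u => cx (tangent gamma u)) t
    (- turning t * cy (tangent gamma t)).
Proof.
pose proof (speed_pos _ _ t hclosed) as Hw.
pose proof (speed_sqr_legendrian t) as Hw2.
destruct hclosed as (_ & (Sx & Sy & _) & _).
apply is_derive_ext with (f := fun u => Derive x u /
  sqrt (Derive x u * Derive x u + Derive y u * Derive y u)).
{ intros u; rewrite <- speed_legendrian; reflexivity. }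
unfold turning; rewrite Hw2.
change (cy (tangent gamma t)) with (Derive y t / speed gamma t).
rewrite speed_legendrian.
apply (is_derive_normalized (Derive x) (Derive y)); [nra| |];
  now apply is_derive_Derive_smooth.
Qed.

Lemma is_derive_cy_tangent (t : R) :
  is_derive (fun u => cy (tangent gamma u)) t
    (turning t * cx (tangent gamma t)).
Proof.
pose proof (speed_pos _ _ t hclosed) as Hw.
pose proof (speed_sqr_legendrian t) as Hw2.
destruct hclosed as (_ & (Sx & Sy & _) & _).
(* Exchanging the two coordinates reverses the sign of the turning. *)
apply is_derive_ext with (f := fun u => Derive y u /
  sqrt (Derive y u * Derive y u + Derive x u * Derive x u)).
{ intros u; rewrite Rplus_comm, <- speed_legendrian; reflexivity. }
replace (turning t * cx (tangent gamma t)) with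
  (- ((Derive y t * Derive (Derive x) t - Derive x t * Derive (Derive y) t) /
      (Derive y t * Derive y t + Derive x t * Derive x t)) *
   (Derive x t / sqrt (Derive y t * Derive y t + Derive x t * Derive x t))).
- apply (is_derive_normalized (Derive y) (Derive x)); [nra| |];
    now apply is_derive_Derive_smooth.
- rewrite (Rplus_comm (Derive y t * Derive y t)), <- speed_legendrian, <- Hw2.
  change (cx (tangent gamma t)) with (Derive x t / speed gamma t).
  unfold turning; field; lra.
Qed.

Lemma tangent_unit_legendrian (t : R) :
  cx (tangent gamma t) * cx (tangent gamma t) +
  cy (tangent gamma t) * cy (tangent gamma t) = 1.
Proof.
pose proof (speed_pos _ _ t hclosed) as Hw.
change (cx (tangent gamma t)) with (Derive x t / speed gamma t).
change (cy (tangent gamma t)) with (Derive y t / speed gamma t).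
replace (_ + _) with ((Derive x t * Derive x t + Derive y t * Derive y t) /
  (speed gamma t * speed gamma t)) by (field; lra).
rewrite <- speed_sqr_legendrian; field; lra.
Qed.

Lemma curvature_speed_legendrian (t : R) :
  curvature gamma t * speed gamma t =
  (Derive x t * Derive (Derive y) t - Derive y t * Derive (Derive x) t) /
  (speed gamma t * speed gamma t).
Proof.
pose proof (speed_pos _ _ t hclosed) as Hw.
fold (turning t).
rewrite curvature_components; unfold d_ds.
assert (Da : Derive (fun u => cx (tangent gamma u)) t =
             - turning t * cy (tangent gamma t))
  by exact (is_derive_unique _ _ _ (is_derive_cx_tangent t)).
assert (Db : Derive (fun u => cy (tangent gamma u)) t =
             turning t * cx (tangent gamma t))
  by exact (is_derive_unique _ _ _ (is_derive_cy_tangent t)).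
rewrite Da, Db.
transitivity (turning t * (cx (tangent gamma t) * cx (tangent gamma t) +
  cy (tangent gamma t) * cy (tangent gamma t))).
- field; lra.
- rewrite tangent_unit_legendrian; ring.
Qed.

Lemma frenet_cx (t : R) :
  is_derive (fun u => cx (tangent gamma u)) t
    (- (curvature gamma t * speed gamma t) * cy (tangent gamma t)).
Proof. rewrite curvature_speed_legendrian; apply is_derive_cx_tangent. Qed.

Lemma frenet_cy (t : R) :
  is_derive (fun u => cy (tangent gamma u)) t
    (curvature gamma t * speed gamma t * cx (tangent gamma t)).
Proof. rewrite curvature_speed_legendrian; apply is_derive_cy_tangent. Qed.

(** * The integrand as an exact derivative *)

(** The function [g(gamma, gamma')]; the Reeb component of the position drops
    out because the tangent is horizontal. *)
Let radial (t : R) : R :=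
  x t * cx (tangent gamma t) + y t * cy (tangent gamma t).

Let integrand (t : R) : R :=
  (1 + curvature gamma t *
       metric (gamma t) (position (gamma t)) (J (gamma t) (tangent gamma t)))
  * speed gamma t.

Lemma is_derive_radial (t : R) : is_derive radial t (integrand t).
Proof.
pose proof (speed_pos _ _ t hclosed) as Hw.
pose proof (tangent_unit_legendrian t) as Hunit.
pose proof (frenet_cx t) as Ha; pose proof (frenet_cy t) as Hb.
destruct hclosed as (_ & (Sx & Sy & _) & _).
pose proof (Derive_correct _ _ (Sx 1%nat t)) as Hx.
pose proof (Derive_correct _ _ (Sy 1%nat t)) as Hy.
assert (Dx : Derive x t = speed gamma t * cx (tangent gamma t)).
{ change (cx (tangent gamma t)) with (Derive x t / speed gamma t); field; lra. }
assert (Dy : Derive y t = speed gamma t * cy (tangent gamma t)).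
{ change (cy (tangent gamma t)) with (Derive y t / speed gamma t); field; lra. }
change (is_derive x t (Derive x t)) in Hx.
change (is_derive y t (Derive y t)) in Hy.
rewrite Dx in Hx; rewrite Dy in Hy.
pose proof (is_derive_plus _ _ _ _ _
  (is_derive_mult _ _ _ _ _ Hx Ha Rmult_comm)
  (is_derive_mult _ _ _ _ _ Hy Hb Rmult_comm)) as H.
match type of H with is_derive _ _ ?l => replace (integrand t) with l end.
{ exact H. }
unfold integrand; rewrite metric_J.
unfold plus, mult; simpl.
change (cx (position (gamma t))) with (x t).
change (cy (position (gamma t))) with (y t).
(* The term [ds/dt (a^2 + b^2)] is the leading [1] of the integrand. *)
rewrite <- Hunit at 1; ring.
Qed.

Lemma continuous_integrand (t : R) : continuous integrand t.
Proof.
pose proof (ex_derive_continuous (K := R_AbsRing) (V := R_NormedModule)) as Hdc.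
pose proof (continuous_plus (U := R_UniformSpace) (V := R_NormedModule)) as Cplus.
pose proof (continuous_minus (U := R_UniformSpace) (V := R_NormedModule)) as Cminus.
pose proof (continuous_mult (U := R_UniformSpace) (K := R_AbsRing)) as Cmult.
pose proof (speed_continuous gamma t (proj1 (proj2 hclosed))) as Cw.
assert (Ca := Hdc _ _ (ex_intro _ _ (frenet_cx t))).
assert (Cb := Hdc _ _ (ex_intro _ _ (frenet_cy t))).
pose proof (speed_pos _ _ t hclosed) as Hw.
assert (E : forall u, speed gamma u + turning u *
  (y u * cx (tangent gamma u) - x u * cy (tangent gamma u)) = integrand u).
{ intros u; unfold integrand, turning.
  rewrite metric_J, <- curvature_speed_legendrian.
  unfold x, y, position; ring. }
apply (continuous_ext _ _ t E); clear E.
destruct hclosed as (_ & (Sx & Sy & _) & _).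
pose proof (smooth_continuous _ t Sx) as x0.
pose proof (smooth_continuous _ t Sy) as y0.
pose proof (smooth_continuous_Derive _ t Sx) as x1.
pose proof (smooth_continuous_Derive _ t Sy) as y1.
assert (x2 : continuous (Derive (Derive x)) t) by exact (Hdc _ _ (Sx 3%nat t)).
assert (y2 : continuous (Derive (Derive y)) t) by exact (Hdc _ _ (Sy 3%nat t)).
assert (Ci : continuous (fun u => / (speed gamma u * speed gamma u)) t).
{ apply continuous_comp with (f := fun u => speed gamma u * speed gamma u).
  - exact (Cmult _ _ t Cw Cw).
  - apply Hdc; auto_derive; nra. }
exact (Cplus _ _ t Cw
  (Cmult _ _ t
    (Cmult _ _ t (Cminus _ _ t (Cmult _ _ t x1 y2) (Cmult _ _ t y1 x2)) Ci)
    (Cminus _ _ t (Cmult _ _ t y0 Ca) (Cmult _ _ t x0 Cb)))).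
Qed.

(** * Periodicity *)

Lemma tangent_periodic (t : R) : tangent gamma (t + P) = tangent gamma t.
Proof.
destruct hclosed as (_ & _ & Hper & _).
unfold tangent, d_ds, speed, velocity.
rewrite !(Derive_periodic _ P t) by (intros u; now rewrite Hper).
now rewrite Hper.
Qed.

Lemma radial_periodic (t : R) : radial (t + P) = radial t.
Proof.
unfold radial, x, y; rewrite tangent_periodic.
now rewrite (proj1 (proj2 (proj2 hclosed)) t).
Qed.

Lemma is_RInt_integrand : is_RInt integrand 0 P 0.
Proof.
replace 0 with (minus (radial P) (radial 0)) at 2.
- apply (is_RInt_derive (V := R_CompleteNormedModule)); intros t _.
  + apply is_derive_radial.
  + apply continuous_integrand.
- rewrite <- (Rplus_0_l P), radial_periodic; apply Rminus_diag_eq; reflexivity.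
Qed.

End Legendrian.

Theorem proposition1p7 (P : R) (gamma : R -> R3)
    (hclosed : closed_immersed_curve P gamma) (hleg : legendrian gamma) :
  is_curve_integral P gamma
    (fun t => 1 + curvature gamma t *
                  metric (gamma t) (position (gamma t)) (J (gamma t) (tangent gamma t)))
    0.
Proof. exact (is_RInt_integrand P gamma hclosed hleg). Qed.
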